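(* Let a mixed-autonomy routing instance with affine latencies $c_i(z_i)=\sum_{j\in[m]}a_i^j z_i^j+b_i$ be given on a general network, possibly with multiple source–destination pairs and $m$ vehicle types. Let $z^*\in\mathcal Z$ be a socially optimal routing, i.e. a minimizer of the social cost $C$ over the set $\mathcal Z$ of feasible routings. Apply the fixed tolls $\tau_i=A_i^T z_i^*$ on every road $i\in[n]$, where $A_i$ is the $m\times m$ matrix each of whose rows is $(a_i^1,\dots,a_i^m)$; that is, users of vehicle type $j$ pay on road $i$ the toll $\tau_i^j=a_i^j\sum_{l\in[m]}z_i^{*l}$. Then any Wardrop Equilibrium $z'$ relative to these tolls satisfies $$C(z')=C(z^* ).$$
   Context: Network: a finite directed graph (parallel edges allowed) with $n$ edges (roads), indexed by $i\in[n]=\{1,\dots,n\}$; there are $m$ vehicle types indexed by $j\in[m]$. Flow is nonatomic. Demand is inelastic and given by finitely many commodities $r\in[R]$, each with a source node $s_r$, destination node $s'_r$, demand $\beta_r\ge 0$ and vehicle type $j_r\in[m]$; $\mathcal P_r$ is the set of simple paths from $s_r$ to $s'_r$. A feasible path flow assigns $f_{r,p}\ge0$ to each $r\in[R]$, $p\in\mathcal P_r$ with $\sum_{p\in\mathcal P_r}f_{r,p}=\beta_r$. It induces the edge routing $z=(z_i^j)$, where $z_i^j=\sum_{r:\,j_r=j}\ \sum_{p\in\mathcal P_r:\,i\in p}f_{r,p}$ is the flow of type $j$ on road $i$. Write $z_i=(z_i^1,\dots,z_i^m)^T$. The set $\mathcal Z$ of feasible routings is the set of edge routings induced by feasible path flows.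 Latency: on road $i$ all vehicle types experience the same latency $c_i(z_i)=\sum_{j\in[m]}a_i^jz_i^j+b_i$ with $a_i^j\ge0$, $b_i\ge0$. Social cost (tolls not counted): $C(z)=\sum_{i\in[n]}\big(\sum_{j\in[m]}z_i^j\big)c_i(z_i)$. Given tolls $\tau_i^j$, a user of type $j$ on road $i$ experiences cost $c_i(z_i)+\tau_i^j$. A feasible routing $z$ is a Wardrop Equilibrium relative to $\tau$ if it is induced by a feasible path flow $f$ such that for all $r\in[R]$ and all $p,p'\in\mathcal P_r$: $f_{r,p}>0$ implies $\sum_{i\in p}(c_i(z_i)+\tau_i^{j_r})\le\sum_{i\in p'}(c_i(z_i)+\tau_i^{j_r})$. *)

(* Defs.v *)
From HB Require Import structures.
From mathcomp Require Import all_boot all_order all_algebra.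
From mathcomp Require Import reals.

Set Implicit Arguments.
Unset Strict Implicit.
Unset Printing Implicit Defensive.

Import Order.TTheory GRing.Theory Num.Theory.
Local Open Scope ring_scope.

(* A mixed-autonomy routing instance with [n] roads, [m] vehicle types and [K]
   commodities on the node set [V].  Roads are named by ['I_n] and carry their
   end points, so parallel edges are allowed. *)
Record instance (R : realType) (V : finType) (n m K : nat) := Instance {
  tail : 'I_n -> V;
  head : 'I_n -> V;
  source : 'I_K -> V;
  dest : 'I_K -> V;
  demand : 'I_K -> R;
  vtype : 'I_K -> 'I_m;
  slope : 'I_n -> 'I_m -> R;
  offset : 'I_n -> R;
  demand_ge0 : forall r, 0 <= demand r;
  slope_ge0 : forall i j, 0 <= slope i j;
  offset_ge0 : forall i, 0 <= offset i
}.

Section Routing.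
Variables (R : realType) (V : finType) (n m K : nat).
Variable I : instance R V n m K.

Fixpoint walk (s : V) (p : seq 'I_n) (t : V) : bool :=
  if p is e :: q then (tail I e == s) && walk (head I e) q t else s == t.

(* No node is visited twice; for s = t only the empty path qualifies. *)
Definition simple_path (s t : V) (p : seq 'I_n) : bool :=
  walk s p t && uniq (s :: map (head I) p).

(* So nothing is lost by letting paths range over the finite type
   [n.-bseq 'I_n] of road sequences of length at most n. *)
Lemma simple_path_size s t p : simple_path s t p -> (size p <= n)%N.
Proof.
case/andP=> _ /= /andP[_ /map_uniq up].
by rewrite -[leqRHS](card_ord n) -(card_uniqP up) max_card.
Qed.

(* The set P_r of simple paths of commodity [r]. *)
Definition paths (r : 'I_K) : pred (n.-bseq 'I_n) :=
  [pred p : n.-bseq 'I_n | simple_path (source I r) (dest I r) p].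

(* Only the values [f r p] with [p] in [paths r] are meaningful. *)
Definition path_flow := 'I_K -> n.-bseq 'I_n -> R.

Definition feasible_flow (f : path_flow) : Prop :=
  (forall r p, p \in paths r -> 0 <= f r p) /\
  (forall r, \sum_(p in paths r) f r p = demand I r).

(* [z i] is the column vector (z_i^1, ..., z_i^m)^T. *)
Definition routing := 'I_n -> 'cV[R]_m.

Definition induced (f : path_flow) : routing := fun i =>
  \col_j \sum_(r | vtype I r == j) \sum_(p in paths r | i \in p) f r p.

Definition feasible (z : routing) : Prop :=
  exists2 f, feasible_flow f & z =1 induced f.

Definition latency (i : 'I_n) (v : 'cV[R]_m) : R :=
  (\sum_j slope I i j * v j 0) + offset I i.

Definition social_cost (z : routing) : R :=
  \sum_i (\sum_j z i j 0) * latency i (z i).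

Definition socially_optimal (z : routing) : Prop :=
  feasible z /\ forall z', feasible z' -> social_cost z <= social_cost z'.

(* [tau i j 0] is the toll paid on road [i] by vehicle type [j]. *)
Definition tolls := 'I_n -> 'cV[R]_m.

Definition path_cost (tau : tolls) (z : routing) (j : 'I_m) (p : n.-bseq 'I_n) : R :=
  \sum_(i in p) (latency i (z i) + tau i j 0).

Definition wardrop_equilibrium (tau : tolls) (z : routing) : Prop :=
  exists f, [/\ feasible_flow f, z =1 induced f &
    forall r p p', p \in paths r -> p' \in paths r -> 0 < f r p ->
      path_cost tau z (vtype I r) p <= path_cost tau z (vtype I r) p'].

Definition slope_mx (i : 'I_n) : 'M[R]_m := \matrix_(k, j) slope I i j.

Definition fixed_toll (z : routing) : tolls := fun i => (slope_mx i)^T *m z i.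

Lemma fixed_tollE z i j : fixed_toll z i j 0 = slope I i j * \sum_l z i l 0.
Proof.
by rewrite !mxE mulr_sumr; apply: eq_bigr => l _; rewrite !mxE.
Qed.

End Routing.

(* Main.v *)
Require Import Defs.
From HB Require Import structures.
From mathcomp Require Import all_boot all_order all_algebra.
From mathcomp Require Import reals ring.

(** The tolls turn the equilibrium condition into optimality.  An equilibrium
    [z'] satisfies the variational inequality
      sum_(i, j) (c_i(z'_i) + tau_i^j) z'_i^j <=
      sum_(i, j) (c_i(z'_i) + tau_i^j) y_i^j      for every feasible [y].
    Let [z] be the optimum; write x_i, x'_i for the total flows of [z], [z'] on
    road i, and L_i, L'_i for the linear parts of the latencies.  At y = z the
    toll terms are x_i L'_i on the left and x_i L_i on the right, while the
    latency terms on the right contain x_i L'_i.  These cross terms cancel, and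
    what remains is C(z') <= C(z). *)

Set Implicit Arguments.
Unset Strict Implicit.
Unset Printing Implicit Defensive.

Import Order.TTheory GRing.Theory Num.Theory.
Local Open Scope ring_scope.

(** Every [p] with positive [f p] attains the minimum of [c], so the left side is the common mass
    times that minimum, which bounds the right side from below. *)
Lemma weighted_sum_minimizers_le (R : realDomainType) (T : finType)
    (P : pred T) (f g c : T -> R) :
  (forall p, P p -> 0 <= f p) -> (forall p, P p -> 0 <= g p) ->
  \sum_(p | P p) f p = \sum_(p | P p) g p ->
  (forall p q, P p -> P q -> 0 < f p -> c p <= c q) ->
  \sum_(p | P p) f p * c p <= \sum_(p | P p) g p * c p.
Proof.
move=> f0 g0 fg fmin.
case: (pickP [pred p | P p && (0 < f p)]) => [p0 /andP[Pp0 fp0] | no_pos].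
- apply: (@le_trans _ _ (\sum_(p | P p) f p * c p0)).
    apply: ler_sum => p Pp; have := f0 p Pp.
    rewrite le_eqVlt => /predU1P[<- | fp]; first by rewrite !mul0r.
    by rewrite ler_pM2l //; exact: fmin.
  rewrite -mulr_suml fg mulr_suml; apply: ler_sum => p Pp.
  by apply: ler_wpM2l; [exact: g0 | exact: fmin].
(* Here the common mass is zero, so [g] vanishes as well. *)
- have fz p : P p -> f p = 0.
    move=> Pp; apply/eqP; rewrite eq_le f0 // andbT leNgt.
    by have /= := no_pos p; rewrite Pp /= => ->.
  have gz p : P p -> g p = 0.
    by apply: (psumr_eq0P g0); rewrite -fg big1.
  by rewrite !big1 // => p Pp; rewrite (fz, gz) ?mul0r.
Qed.

Section Routing.
Variables (R : realType) (V : finType) (n m K : nat).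
Variable I : instance R V n m K.

(** Passes from road-wise sums to path costs, where the equilibrium condition is stated. *)
Lemma sum_induced (f : path_flow R n K) (w : 'I_n -> 'I_m -> R) :
  \sum_i \sum_j w i j * induced I f i j 0 =
  \sum_r \sum_(p in paths I r) f r p * \sum_(i in p) w i (vtype I r).
Proof.
transitivity (\sum_i \sum_r \sum_(p in paths I r | i \in p)
                f r p * w i (vtype I r)).
  apply: eq_bigr => i _.
  rewrite [RHS](partition_big (vtype I) predT) //=.
  apply: eq_bigr => j _; rewrite mxE mulr_sumr.
  apply: eq_bigr => r /eqP <-; rewrite mulr_sumr.
  by apply: eq_bigr => p _; rewrite mulrC.
rewrite exchange_big /=; apply: eq_bigr => r _.
under [RHS]eq_bigr do rewrite mulr_sumr.
by rewrite [RHS](exchange_big_dep predT).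
Qed.

Lemma wardrop_variational_inequality (tau : tolls R n m)
    (z' z : routing R n m) :
  wardrop_equilibrium I tau z' -> feasible I z ->
  \sum_i \sum_j (latency I i (z' i) + tau i j 0) * z' i j 0 <=
  \sum_i \sum_j (latency I i (z' i) + tau i j 0) * z i j 0.
Proof.
move=> [f [[f0 fd] z'f fmin]] [g [g0 gd] zg].
(* Prices stay frozen at [z'] for both flows, so the comparison splits over commodities. *)
set w := fun i j => latency I i (z' i) + tau i j 0.
have flowE (y : routing R n m) h : y =1 induced I h ->
    \sum_i \sum_j w i j * y i j 0 =
    \sum_r \sum_(p in paths I r) h r p * path_cost I tau z' (vtype I r) p.
  move=> yh; rewrite /path_cost -(sum_induced h w).
  by apply: eq_bigr => i _; apply: eq_bigr => j _; rewrite yh.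
rewrite (flowE _ _ z'f) (flowE _ _ zg); apply: ler_sum => r _.
apply: weighted_sum_minimizers_le; [exact: f0 | exact: g0 | | exact: fmin].
by rewrite fd gd.
Qed.

(** Both sides agree road by road, once the cross terms cancel. *)
Lemma fixed_toll_cost_gap (zs z' : routing R n m) :
  \sum_i \sum_j (latency I i (z' i) + fixed_toll I zs i j 0) * zs i j 0 -
  \sum_i \sum_j (latency I i (z' i) + fixed_toll I zs i j 0) * z' i j 0 =
  social_cost I zs - social_cost I z'.
Proof.
have edgeE i (y : routing R n m) :
    \sum_j (latency I i (z' i) + fixed_toll I zs i j 0) * y i j 0 =
    latency I i (z' i) * (\sum_j y i j 0) +
    (\sum_l zs i l 0) * (\sum_j slope I i j * y i j 0).
  rewrite !mulr_sumr -big_split; apply: eq_bigr => j _ /=.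
  by rewrite fixed_tollE; ring.
rewrite /social_cost -!sumrB; apply: eq_bigr => i _.
by rewrite !edgeE /latency; ring.
Qed.

End Routing.

Theorem theorem1 (R : realType) (V : finType) (n m K : nat)
    (I : instance R V n m K) (zstar z' : routing R n m) :
  socially_optimal I zstar ->
  wardrop_equilibrium I (fixed_toll I zstar) z' ->
  social_cost I z' = social_cost I zstar.
Proof.
move=> [zs_feas zs_min] we; apply/eqP; rewrite eq_le; apply/andP; split.
  rewrite -subr_ge0 -fixed_toll_cost_gap subr_ge0.
  exact: wardrop_variational_inequality.
by apply: zs_min; case: we => f [ff z'f _]; exists f.
Qed.
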